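(* Let $P$ be a finite totally ordered set (a $1$-Vee), fix a weight $(a,b)\in\mathbb{N}\times\mathbb{N}$, and let $I=\bigoplus_{s\in S}I_s$ and $M=\bigoplus_{t\in T}M_t$ be $A(P)$-modules that are finite direct sums of convex modules $I_s$, $M_t$. Let $\Lambda=\Lambda_\epsilon\in\mathcal{T}(P)$ be the maximal translation with $h(\Lambda)=\epsilon$. Suppose there exists a $(\Lambda,\Lambda)$-interleaving between $I$ and $M$. Then there exists an $h(\Lambda)$-matching from $B(I)$ to $B(M)$.
   Context: **Modules.** $K$ is a field. For a finite poset $P$, an $A(P)$-module is a functor $M$ from $P$ to finite-dimensional $K$-vector spaces, with structure maps $M(x\le y)$; morphisms are natural transformations. $\mathrm{Supp}(M)=\{x:M(x)\neq0\}$. Put $P^+=P\cup\{\infty\}$ with $p\le\infty$ for all $p\in P$; an $A(P)$-module is regarded as a functor on $P^+$ with $M(\infty)=0$. An indecomposable module $M$ is convex if $\dim_K M(x)\in\{0,1\}$ for all $x$ and $M$ is isomorphic to a module $M'$ with $M'(x\le y)=\mathrm{Id}_K$ for all $x\le y$ in $\mathrm{Supp}(M')$. The barcode $B(M)$ of a direct sum $M$ of convex modules is the multiset of isomorphism classes of its convex summands. **Translations.** $\mathcal{T}(P)$ is the set of order-preserving maps $\Lambda:P^+\to P^+$ with $\Lambda p\ge p$ for all $p$, partially ordered pointwise. $M\Lambda$ is the module $(M\Lambda)(p)=M(\Lambda p)$, $(M\Lambda)(p\le q)=M(\Lambda p\le\Lambda q)$; for a morphism $f$, $(f\Lambda)(p)=f(\Lambda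 p)$. **Weights and height.** A weight is a pair $(a,b)$ of positive integers. In the Hasse diagram of $P^+$, covering edges between elements of $P$ get weight $a$, and the edge joining the maximal element of $P$ to $\infty$ gets weight $b$; $d=d_{a,b}$ is the weighted graph metric on $P^+$, and $h(\Lambda)=\max\{d(x,\Lambda x):x\in P^+\}$. For $\epsilon$ in the set of heights $\{h(\Gamma):\Gamma\in\mathcal{T}(P)\}$, $\Lambda_\epsilon$ denotes the unique maximal element of $\{\Gamma\in\mathcal{T}(P):h(\Gamma)=\epsilon\}$; explicitly, $\Lambda_\epsilon(x)=\max\{y\ge x:d(x,y)\le\epsilon\}$. **Interleavings.** A $(\Gamma,\Lambda)$-interleaving between $M$ and $N$ is a pair of morphisms $\phi:M\to N\Lambda$, $\psi:N\to M\Gamma$ such that $(\psi\Lambda)\circ\phi$ is the canonical map $M\to M\Gamma\Lambda$ with components $M(p\le\Gamma\Lambda p)$ and $(\phi\Gamma)\circ\psi$ is the canonical map $N\to N\Lambda\Gamma$ with components $N(p\le\Lambda\Gamma p)$. The interleaving distance is $D(M,N)=\inf\{\epsilon:\text{there is a }(\Gamma,\Lambda)\text{-interleaving between } M, N \text{ with } h(\Gamma),h(\Lambda)\le\epsilon\}$. **Width and matchings.** For convex $J$, $W(J)=\min\{\epsilon:\exists\,\Lambda,\Gamma\in\mathcal{T}(P),\ h(\Lambda),h(\Gamma)\le\epsilon,\ \mathrm{Hom}(J,J\Lambda\Gamma)=0\}$. A matching from a multiset $S$ to a multiset $T$ of isomorphism classes of convex modules is a bijection $f:S'\to T'$ between multisubsets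 $S'\subseteq S$, $T'\subseteq T$. For $\epsilon\ge0$ it is an $\epsilon$-matching if every $s\in S$ with $W(s)>\epsilon$ lies in $S'$, every $t\in T$ with $W(t)>\epsilon$ lies in $T'$, and $D(s,f(s))\le\epsilon$ for all $s\in S'$. *)

(* Defs.v *)
From HB Require Import structures.
From mathcomp Require Import all_boot all_order all_algebra.
From mathcomp Require Import boolp.

Set Implicit Arguments.
Unset Strict Implicit.
Unset Printing Implicit Defensive.

Import Order.TTheory GRing.Theory.
Local Open Scope order_scope.

Section MinNat.
Variables (A : nat -> Prop) (exA : exists n, A n).

Lemma ex_asbool : exists n, `[< A n >].
Proof. by case: exA => n An; exists n; apply/asboolP. Qed.

Definition min_nat : nat := ex_minn ex_asbool.

Lemma min_natP : A min_nat /\ forall n, A n -> (min_nat <= n)%N.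
Proof.
rewrite /min_nat; case: ex_minnP => m /asboolP Am le_m; split=> // n An.
by apply: le_m; apply/asboolP.
Qed.
End MinNat.

(* [plus P] is P^+, with [Some p] for p in P and [None] for infinity. *)
Definition plus (P : Type) : Type := option P.

HB.instance Definition _ (P : choiceType) := Choice.copy (plus P) (option P).
HB.instance Definition _ (P : finType) := Finite.copy (plus P) (option P).

Section PlusOrder.
Variables (d : Order.disp_t) (P : porderType d).

Definition plus_le (x y : plus P) : bool :=
  match x, y with
  | _, None => true
  | None, Some _ => false
  | Some p, Some q => p <= q
  end.

Fact plus_le_refl : reflexive plus_le.
Proof. by case=> //= p. Qed.

Fact plus_le_anti : antisymmetric plus_le.
Proof. by case=> [p|] [q|] //= /le_anti ->. Qed.

Fact plus_le_trans : transitive plus_le.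
Proof. by case=> [q|] [p|] [r|] //=; apply: le_trans. Qed.

HB.instance Definition _ :=
  Order.Le_isPOrder.Build d (plus P)
  plus_le_refl plus_le_anti plus_le_trans.

Lemma plus_le_top (x : plus P) : x <= None.
Proof. by case: x. Qed.
End PlusOrder.

HB.instance Definition _ (d : Order.disp_t) (P : finPOrderType d) :=
  Finite.on (plus P).

Section Translations.
Variables (d : Order.disp_t) (P : finPOrderType d).

Record translation := Translation {
  tfun :> plus P -> plus P;
  t_homo : forall x y, x <= y -> tfun x <= tfun y;
  t_ge : forall x, x <= tfun x }.

Definition translation_le (L G : translation) : Prop := forall x, L x <= G x.

Lemma t_comp_ge (L G : translation) x : x <= G (L x).
Proof. exact: le_trans (t_ge L x) (t_ge G (L x)). Qed.

Lemma t_infty (L : translation) : L None = None.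
Proof. by apply: le_anti; rewrite t_ge plus_le_top. Qed.

Definition top_translation : translation :=
  @Translation (fun=> None) (fun _ _ _ => lexx _) (@plus_le_top d P).
End Translations.

Section Metric.
Variables (d : Order.disp_t) (P : finPOrderType d) (a b : nat).
Implicit Types x y : plus P.

Definition covers x y : bool :=
  (x < y) && ~~ [exists z : plus P, (x < z) && (z < y)].

Definition hasse_adj : rel (plus P) := fun x y => covers x y || covers y x.

Definition edge_weight x y : nat :=
  if (x == None) || (y == None) then b else a.

Definition path_weight x (p : seq (plus P)) : nat :=
  sumn (pairmap edge_weight x p).

Definition path_of_weight x y (n : nat) : Prop :=
  exists p : seq (plus P),
    [/\ path hasse_adj x p, last x p = y & path_weight x p = n].

Lemma path_of_weight_sym x y n : path_of_weight x y n -> path_of_weight y x n.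
Proof.
case=> p [].
elim: p x n => [|z p IH] x n /=; first by move=> _ -> <-; exists [::].
case/andP=> xz zp lp <-; have [q [yq lq wq]] := IH z _ zp lp erefl.
exists (rcons q x); split; rewrite ?last_rcons ?rcons_path ?lq ?yq //=.
  by move: xz; rewrite /hasse_adj orbC.
move: wq; rewrite /path_weight -cats1 pairmap_cat sumn_cat /= lq addn0 => ->.
by rewrite /edge_weight orbC addnC.
Qed.

Lemma path_of_weight_trans x y z m n :
  path_of_weight x y m -> path_of_weight y z n -> path_of_weight x z (m + n).
Proof.
case=> p [xp lp <-] [q [yq lq <-]]; exists (p ++ q).
by rewrite cat_path last_cat /path_weight pairmap_cat sumn_cat lp xp yq lq.
Qed.

Lemma ex_path_top x : exists n, path_of_weight x None n.
Proof.
have [k le_k] := ubnP #|[pred z : plus P | x < z]|.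
elim: k x le_k => // k IH x le_k.
have [->|nx] := eqVneq x None; first by exists 0; exists [::].
have xt : x < None by rewrite lt_def eq_sym nx plus_le_top.
pose up z := [pred t : plus P | (x < t) && (t < z)].
case: (@arg_minnP _ None [pred z : plus P | x < z] (fun z => #|up z|) xt).
move=> z /= xz zmin.
have cov : covers x z.
  rewrite /covers xz /=; apply/existsP=> -[t /andP[xt' tz]].
  have := zmin t xt'; rewrite leqNgt => /negP; apply.
  apply: proper_card; apply/properP; split.
    by apply/subsetP=> u; rewrite !inE => /andP[-> ut]; exact: lt_trans ut tz.
  by exists t; rewrite !inE ?xt' ?tz // ltxx andbF.
have [|n zn] := IH z.
  apply: leq_trans (le_k : (_ <= k)%N); apply: proper_card; apply/properP; split.
    by apply/subsetP=> u; rewrite !inE; apply: lt_trans.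
  by exists z; rewrite !inE ?xz ?ltxx.
exists (edge_weight x z + n)%N; apply: path_of_weight_trans zn.
by exists [:: z]; rewrite /= /hasse_adj cov /path_weight /= addn0.
Qed.

Lemma ex_path x y : exists n, path_of_weight x y n.
Proof.
have [m xm] := ex_path_top x; have [n yn] := ex_path_top y.
by exists (m + n)%N; apply: path_of_weight_trans xm (path_of_weight_sym yn).
Qed.

Definition dist x y : nat := min_nat (ex_path x y).

Definition height (L : translation P) : nat :=
  (\max_(x : plus P) dist x (L x))%N.

Definition maximal_translation (e : nat) (L : translation P) : Prop :=
  height L = e /\
  forall G : translation P,
    height G = e -> translation_le L G -> translation_le G L.
End Metric.

Section Modules.
Variables (K : fieldType) (d : Order.disp_t) (P : finPOrderType d).

(* A(P)-modules, as functors on P^+ that vanish at infinity. *)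
Record amod := AMod {
  obj :> plus P -> vectType K;
  smap : forall x y : plus P, x <= y -> 'Hom(obj x, obj y);
  smap_id : forall x (h : x <= x), smap h = \1%VF;
  smap_comp : forall x y z (hxy : x <= y) (hyz : y <= z) (hxz : x <= z),
    smap hxz = (smap hyz \o smap hxy)%VF;
  obj_infty : \dim {: obj None} = 0 }.

Record amor (M N : amod) := AMor {
  mfun :> forall x : plus P, 'Hom(M x, N x);
  mfun_nat : forall x y (h : x <= y),
    (smap N h \o mfun x)%VF = (mfun y \o smap M h)%VF }.

Definition iso (M N : amod) : Prop :=
  exists (f : amor M N) (g : amor N M),
    forall x, (g x \o f x)%VF = \1%VF /\ (f x \o g x)%VF = \1%VF.

Definition supp (M : amod) : {set plus P} := [set x | \dim {: M x} != 0].

Definition is_zero (M : amod) : Prop := supp M = set0.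

Definition zero_amod : amod.
Proof.
refine (@AMod (fun=> 'rV[K]_0) (fun _ _ _ => \1%VF) _ _ _).
- by [].
- by move=> *; rewrite comp_lfun1l.
- by rewrite dimvf.
Defined.

Section PairMap.
Variables (U1 U2 V1 V2 : vectType K) (f : 'Hom(U1, V1)) (g : 'Hom(U2, V2)).

Definition pair_fun (u : U1 * U2) : V1 * V2 := (f u.1, g u.2).

Fact pair_fun_linear : linear pair_fun.
Proof. by move=> c u v; rewrite /pair_fun !linearP. Qed.

HB.instance Definition _ :=
  GRing.isLinear.Build K (U1 * U2)%type (V1 * V2)%type _ pair_fun
    pair_fun_linear.

Definition pair_lfun : 'Hom((U1 * U2)%type, (V1 * V2)%type) := linfun pair_fun.

Lemma pair_lfunE u : pair_lfun u = (f u.1, g u.2).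
Proof. by rewrite lfunE. Qed.
End PairMap.

Definition dsum (M N : amod) : amod.
Proof.
refine (@AMod (fun x => (M x * N x)%type : vectType K)
          (fun x y h => pair_lfun (smap M h) (smap N h)) _ _ _).
- move=> x h; apply/lfunP=> u.
  by rewrite pair_lfunE !smap_id !id_lfunE -surjective_pairing.
- move=> x y z hxy hyz hxz; apply/lfunP=> u.
  by rewrite comp_lfunE !pair_lfunE !(smap_comp _ hxy hyz hxz) !comp_lfunE.
- have := obj_infty M; have := obj_infty N; rewrite !dimvf => N0 M0.
  by rewrite [LHS](_ : _ = (dim (M None) + dim (N None))%N) // M0 N0.
Defined.

Definition indecomposable (M : amod) : Prop :=
  ~ is_zero M /\
  forall N1 N2 : amod, iso M (dsum N1 N2) -> is_zero N1 \/ is_zero N2.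

Definition vcast (U V : vectType K) (e : U = V) : U -> V :=
  match e in _ = W return U -> W with erefl => id end.

(* Every space of the support is K itself, and every structure map between two
   such spaces is Id_K; [vcast] only transports along the equalities of spaces. *)
Definition all_identities (M : amod) : Prop :=
  exists e : forall x, x \in supp M -> M x = (K^o : vectType K),
  forall (x y : plus P) (h : x <= y) (hx : x \in supp M) (hy : y \in supp M) (v : M x),
    vcast (e y hy) (smap M h v) = vcast (e x hx) v.

Definition convex (M : amod) : Prop :=
  [/\ indecomposable M,
      forall x, \dim {: M x} = 0 \/ \dim {: M x} = 1
    & exists M' : amod, iso M M' /\ all_identities M'].

(* M Lambda *)
Definition tshift (M : amod) (L : translation P) : amod.
Proof.
refine (@AMod (fun x => M (L x)) (fun x y h => smap M (t_homo L h)) _ _ _).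
- by move=> x h; apply: smap_id.
- by move=> x y z hxy hyz hxz; apply: smap_comp.
- by rewrite t_infty; apply: obj_infty.
Defined.

(* f Lambda *)
Definition mshift (M N : amod) (f : amor M N) (L : translation P) :
    amor (tshift M L) (tshift N L).
Proof.
refine (@AMor (tshift M L) (tshift N L) (fun x => f (L x)) _).
by move=> x y h; exact: (mfun_nat f (t_homo L h)).
Defined.

Definition is_interleaving (M N : amod) (G L : translation P)
    (phi : amor M (tshift N L)) (psi : amor N (tshift M G)) : Prop :=
  (forall p : plus P,
     (mshift psi L p \o phi p)%VF = smap M (t_comp_ge L G p)) /\
  (forall p : plus P,
     (mshift phi G p \o psi p)%VF = smap N (t_comp_ge G L p)).

Definition interleaved (M N : amod) (G L : translation P) : Prop :=
  exists (phi : amor M (tshift N L)) (psi : amor N (tshift M G)),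
    is_interleaving phi psi.

Definition hom_zero (M N : amod) : Prop :=
  forall (f : amor M N) (x : plus P), f x = 0%R.

Lemma hom_infty_zero (M : amod) (U : vectType K) (f : 'Hom(U, M None)) :
  f = 0%R.
Proof.
apply/lfunP=> u; rewrite lfunE /=; apply/eqP.
have /eqP := obj_infty M; rewrite dimv_eq0 => /eqP M0.
by rewrite -memv0 -M0 memvf.
Qed.

Variables (a b : nat).

Definition width_bound (J : amod) (e : nat) : Prop :=
  exists L G : translation P,
    [/\ (height a b L <= e)%N, (height a b G <= e)%N
      & hom_zero J (tshift (tshift J L) G)].

Lemma ex_width_bound (J : amod) : exists e, width_bound J e.
Proof.
exists (height a b (top_translation P)).
exists (top_translation P), (top_translation P); split=> // f x.
exact: hom_infty_zero.
Qed.

Definition width (J : amod) : nat := min_nat (ex_width_bound J).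

Definition interleaving_bound (M N : amod) (e : nat) : Prop :=
  exists G L : translation P,
    [/\ (height a b G <= e)%N, (height a b L <= e)%N & interleaved M N G L].

Lemma ex_interleaving_bound (M N : amod) : exists e, interleaving_bound M N e.
Proof.
pose T := top_translation P.
exists (height a b T), T, T; split=> //.
have Z (A B : amod) : amor A (tshift B T).
  apply: (@AMor A (tshift B T) (fun=> 0%R)) => x y h.
  by rewrite comp_lfun0l comp_lfun0r.
exists (Z M N), (Z N M); split=> p.
- exact: etrans (@hom_infty_zero M _ _) (esym (@hom_infty_zero M _ _)).
- exact: etrans (@hom_infty_zero N _ _) (esym (@hom_infty_zero N _ _)).
Qed.

(* Heights are natural numbers, so the infimum defining the interleaving
   distance is attained, and it is the same over natural and over real bounds. *)
Definition interleaving_dist (M N : amod) : nat :=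
  min_nat (ex_interleaving_bound M N).
End Modules.

(* A multiset of isomorphism classes is given by a finite family [I_ : S -> amod]
   of representatives, one index per element counted with multiplicity; the
   barcode of [\big[dsum/zero]_s I_ s] is the family [I_].  A matching is then a
   bijection between subsets of the two index sets. *)
Record matching (S T : finType) := Matching {
  m_dom : {set S};
  m_cod : {set T};
  m_fun :> {s : S | s \in m_dom} -> {t : T | t \in m_cod};
  m_bij : bijective m_fun }.

Definition eps_matching (K : fieldType) (d : Order.disp_t)
    (P : finPOrderType d) (a b : nat) (S T : finType)
    (I_ : S -> amod K P) (M_ : T -> amod K P) (e : nat)
    (f : matching S T) : Prop :=
  [/\ forall s, (e < width a b (I_ s))%N -> s \in m_dom f,
      forall t, (e < width a b (M_ t))%N -> t \in m_cod f
    & forall s : {s : S | s \in m_dom f},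
        (interleaving_dist a b (I_ (val s)) (M_ (val (f s))) <= e)%N].

(* Main.v *)
Require Import Defs.
From HB Require Import structures.
From mathcomp Require Import all_boot all_order all_algebra.
From mathcomp Require Import boolp.

(** Over a chain a convex module is an interval module: its support is
    [x, y) with x, y in P^+, and it is determined by x and y.  For a translation
    L, say that [x, y) and [u, v) are L-close when u <= L x, x <= L u, v <= L y
    and y <= L v ([shift_close]); L-close interval modules are (L, L)-interleaved
    by the evident maps ([close_interleaved]).  Say that [x, y) is significant
    when L (L x) < y; an interval that is not significant admits no nonzero map
    to its shift by L twice, so its width is at most h(L)
    ([lt_width_significant]).  It therefore suffices to find a matching between
    L-close intervals that covers all significant ones on both sides.

    By the theorem of Mendelsohn and Dulmage it is enough to cover the
    significant intervals of one side at a time, and by Hall's theorem this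
    reduces to an inequality: a set A of significant intervals of I has at least
    #|A| L-close partners in the barcode of M ([hall_condition]).

    The inequality is a rank estimate.  In bases adapted to the decompositions,
    the two morphisms of the interleaving have scalar entries Phi i t and
    Psi t j, and the interleaving identity says that Phi * Psi agrees with the
    identity matrix in every position (i, j) where interval j is still alive at
    the point L (L x), for x the lower end of interval i ([sum_entries]).  If
    Phi i t and Psi t j are both nonzero, then t is L-close to i or to j, unless
    j precedes i in the sense of [precedes] ([close_to_either]); and if i and j
    are significant and j is no longer alive at L (L x), then again j precedes i.
    Hence the product of the parts of Phi and Psi that use only partners t of A
    agrees with the identity at every (i, j) in A where j does not precede i.
    Every nonempty set of intervals contains one that no other member precedes
    ([exists_unpreceded]), which makes this product unitriangular in a suitable
    order, so it has rank #|A|, and there must be at least #|A| partners.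

    The argument is modelled on Bjerkevik's proof of algebraic stability, with
    [precedes] in the role that the comparison of centres of intervals has
    there. *)

Set Implicit Arguments.
Unset Strict Implicit.
Unset Printing Implicit Defensive.

Import Order.TTheory GRing.Theory.

(** * Matchings in finite bipartite graphs *)

Section Matchings.
Variables S T : finType.
Implicit Types (E : S -> T -> bool) (F G : {set S * T}).

(** A matching is kept as its set of edges, so that it can be assembled by
    unions and needs no default value outside its domain. *)
Definition edge_matching F : Prop :=
  {in F &, forall p q, (p.1 == q.1) = (p.2 == q.2)}.

Definition neighbours E (A : {set S}) : {set T} :=
  [set t | [exists s in A, E s t]].

Lemma neighboursP E (A : {set S}) t :
  reflect (exists2 s, s \in A & E s t) (t \in neighbours E A).
Proof. by rewrite inE; apply: exists_inP. Qed.

Lemma edge_matchingU F G :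
  edge_matching F -> edge_matching G ->
  (forall p q, p \in F -> q \in G -> p.1 != q.1 /\ p.2 != q.2) ->
  edge_matching (F :|: G).
Proof.
move=> mF mG FG p q; rewrite !inE => /orP[pF|pG] /orP[qF|qG].
- exact: mF.
- by have [/negbTE-> /negbTE->] := FG p q pF qG.
- by rewrite [LHS]eq_sym [RHS]eq_sym; have [/negbTE-> /negbTE->] := FG q p qF pG.
- exact: mG.
Qed.

(** Induction on #|A|.  If some nonempty proper subset C of A is tight, match C
    with its neighbours, and A minus C outside them; tightness gives the
    hypothesis for the second part.  Otherwise every such C has a neighbour to
    spare, so one edge can be chosen at will and its end points removed. *)
Theorem hall_marriage E (A : {set S}) :
  (forall C : {set S}, C \subset A -> #|C| <= #|neighbours E C|) ->
  exists F, [/\ edge_matching F,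
                forall p, p \in F -> E p.1 p.2 /\ p.1 \in A
              & A \subset [set p.1 | p in F]].
Proof.
have [n] := ubnP #|A|; elim: n E A => // n IH E A ltA hall.
have [->|[s sA]] := set_0Vmem A.
  exists set0; split; rewrite ?sub0set //; first by move=> p q; rewrite inE.
  by move=> p; rewrite inE.
case: (boolP [exists C : {set S},
         [&& C != set0, C \proper A & #|neighbours E C| <= #|C|]]).
  case/existsP=> C /and3P[C0 pCA tight].
  have sCA := proper_sub pCA.
  pose E' s t := E s t && (t \notin neighbours E C).
  have [||F [mF FE FC]] := IH E C.
  - by apply: leq_trans (proper_card pCA) _.
  - by move=> D DC; apply: hall; apply: subset_trans DC sCA.
  have [||G [mG GE GC]] := IH E' (A :\: C).
  - apply: leq_trans _ (ltA : (#|A| <= n)%N); rewrite cardsD.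
    rewrite (setIidPr sCA) ltn_subrL !card_gt0 C0.
    by apply/set0Pn; exists s.
  - move=> D DAC; rewrite -(leq_add2r #|C|) -cardsUI.
    have -> : D :&: C = set0.
      by apply/setP=> z; rewrite !inE; apply/andP=> -[/(subsetP DAC)];
        rewrite inE => /andP[/negbTE->].
    rewrite cards0 addn0; apply: leq_trans (hall _ _) _.
      by rewrite subUset sCA andbT (subset_trans DAC) ?subsetDl.
    apply: leq_trans _ (leq_add (leqnn _) tight).
    apply: leq_trans (leq_card_setU _ _); apply: subset_leq_card.
    apply/subsetP=> t /neighboursP[z]; rewrite !inE => /orP[zD|zC] zt.
      case: (boolP (t \in neighbours E C)) => [|tC].
        by rewrite inE => ->; rewrite orbT.
      by apply/orP; left; apply/exists_inP; exists z => //; rewrite /E' zt.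
    by apply/orP; right; apply/exists_inP; exists z.
  exists (F :|: G); split.
  - apply: edge_matchingU => // p q pF qG.
    have [Ep pC] := FE p pF; have [/andP[_ qN] qC] := GE q qG.
    split; first by apply: contraTneq qC => <-; rewrite inE pC.
    by apply: contraNneq qN => <-; apply/neighboursP; exists p.1.
  - move=> p; rewrite inE => /orP[/FE[Ep pC]|/GE[/andP[Ep _] pC]]; split=> //.
      exact: (subsetP sCA).
    by move: pC; rewrite inE => /andP[].
  - rewrite imsetU; apply/subsetP=> z zA; rewrite inE.
    have [zC|zC] := boolP (z \in C); first by rewrite (subsetP FC).
    by rewrite (subsetP GC) ?orbT // inE zC.
move/existsPn=> slack.
have : 0 < #|neighbours E [set s]|.
  by apply: leq_trans (hall _ _); rewrite ?cards1 ?sub1set.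
case/card_gt0P=> t /neighboursP[_ /set1P-> st].
pose E' z u := E z u && (u != t).
have [||F [mF FE FA]] := IH E' (A :\ s).
- by move: ltA; rewrite (cardsD1 s) sA.
- move=> C CA; have [->|C0] := eqVneq C set0; first by rewrite cards0.
  have ltC : #|C| < #|neighbours E C|.
    have := slack C; rewrite C0 /= ltnNge; apply: contraNN => ->; rewrite andbT.
    exact: sub_proper_trans CA (properD1 sA).
  rewrite -ltnS; apply: leq_trans ltC _.
  apply: leq_trans (_ : _ <= #|t |: neighbours E' C|) _; last first.
    by rewrite cardsU1; case: (_ \notin _).
  apply: subset_leq_card; apply/subsetP=> u /neighboursP[z zC zu].
  rewrite in_setU1; have [//|ut] := eqVneq u t.
  by apply/neighboursP; exists z => //; rewrite /E' zu.
exists ((s, t) |: F); split.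
- apply: edge_matchingU => //; first by move=> p q /set1P-> /set1P->; rewrite !eqxx.
  move=> p q /set1P-> /FE[/andP[_ qt] /setD1P[qs _]] /=.
  by rewrite eq_sym qs eq_sym qt.
- by move=> p; rewrite in_setU1 => /orP[/eqP->|/FE[/andP[Ep _] /setD1P[]]].
- apply/subsetP=> z zA; have [->|zs] := eqVneq z s.
    by apply/imsetP; exists (s, t); rewrite ?setU11.
  have /imsetP[p pF ->] : z \in [set p.1 | p in F].
    by rewrite (subsetP FA) // !inE zs.
  by apply/imsetP; exists p => //; rewrite setU1r.
Qed.

(** As in the Cantor-Bernstein theorem: choose X so that X consists of the
    elements of A not reached by G from the part Y of B not reached by F from X;
    then F on X and G on Y together form a matching.  Such an X is a fixed point
    of a monotone operator. *)
Theorem mendelsohn_dulmage F G (A : {set S}) (B : {set T}) :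
  edge_matching F -> edge_matching G ->
  A \subset [set p.1 | p in F] -> B \subset [set p.2 | p in G] ->
  exists H, [/\ edge_matching H, H \subset F :|: G,
                A \subset [set p.1 | p in H] & B \subset [set p.2 | p in H]].
Proof.
move=> mF mG AF BG.
pose fwd (X : {set S}) := [set p.2 | p in F & p.1 \in X].
pose bwd (Y : {set T}) := [set p.1 | p in G & p.2 \in Y].
have fwdS (X X' : {set S}) : X \subset X' -> fwd X \subset fwd X'.
  move=> XX; apply: imsetS; apply/subsetP=> p; rewrite !inE => /andP[-> /=].
  exact: subsetP.
have bwdS (X X' : {set T}) : X \subset X' -> bwd X \subset bwd X'.
  move=> XX; apply: imsetS; apply/subsetP=> p; rewrite !inE => /andP[-> /=].
  exact: subsetP.
pose step (X : {set S}) := A :\: bwd (B :\: fwd X).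
have stepS : {homo step : X Y / X \subset Y}.
  by move=> X Y XY; apply: setDS; apply: bwdS; apply: setDS; apply: fwdS.
have := fixsetK stepS; set X := fixset step => fixX.
pose Y := B :\: fwd X.
have XE : X = A :\: bwd Y by rewrite -[LHS]fixX.
pose HF := [set p in F | p.1 \in X]; pose HG := [set p in G | p.2 \in Y].
have sHF : HF \subset F by apply/subsetP=> p; rewrite inE => /andP[].
have sHG : HG \subset G by apply/subsetP=> p; rewrite inE => /andP[].
exists (HF :|: HG); split.
- apply: edge_matchingU.
  + by move=> p q /(subsetP sHF) pF /(subsetP sHF); apply: mF.
  + by move=> p q /(subsetP sHG) pF /(subsetP sHG); apply: mG.
  move=> p q pF qG; have := pF; have := qG; rewrite !inE.
  move=> /and3P[_ qX _] /andP[_ pX].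
  split.
    move: pX; rewrite XE inE => /andP[pY _]; apply: contraNneq pY => ->.
    exact: imset_f.
  by apply: contraNneq qX => <-; exact: imset_f.
- exact: setUSS.
- rewrite imsetU; apply/subsetP=> s sA; rewrite inE orbC.
  have [//|/negbTE sY] := boolP (s \in bwd Y); rewrite /=.
  have sX : s \in X by rewrite XE inE sY sA.
  have /imsetP[p pF es] := subsetP AF s sA.
  by apply/imsetP; exists p => //; rewrite inE pF -es.
- rewrite imsetU; apply/subsetP=> t tB; rewrite inE.
  have [//|/negbTE tX] := boolP (t \in fwd X); rewrite /=.
  have tY : t \in Y by rewrite inE tX tB.
  have /imsetP[p pG et] := subsetP BG t tB.
  by apply/imsetP; exists p => //; rewrite inE pG -et.
Qed.

Lemma edge_matching_bij F : edge_matching F ->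
  exists f : matching S T,
    [/\ m_dom f = [set p.1 | p in F], m_cod f = [set p.2 | p in F]
      & forall s, (val s, val (f s)) \in F].
Proof.
move=> mF.
pose D := [set p.1 | p in F]; pose C := [set p.2 | p in F].
have exf (s : {s | s \in D}) : exists t : {t | t \in C}, (val s, val t) \in F.
  case: s => s sD /=; have /imsetP[p pF es] := sD.
  by exists (exist _ p.2 (imset_f snd pF)); rewrite es -surjective_pairing.
have exg (t : {t | t \in C}) : exists s : {s | s \in D}, (val s, val t) \in F.
  case: t => t tC /=; have /imsetP[p pF et] := tC.
  by exists (exist _ p.1 (imset_f fst pF)); rewrite et -surjective_pairing.
have [f fF] := choice exf; have [g gF] := choice exg.
have fg : bijective f.
  exists g => [s|t]; apply/val_inj/eqP.
    by have /= -> := mF _ _ (gF (f s)) (fF s).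
  by have /= <- := mF _ _ (fF (g t)) (gF t).
by exists (Matching fg).
Qed.

End Matchings.

(** * Linear algebra *)

Local Open Scope ring_scope.

Lemma wide_system_kernel (K : fieldType) (S T : finType) (A : {set S})
    (B : {set T}) (M : T -> S -> K) :
  (#|B| < #|A|)%N ->
  exists2 c : S -> K, (exists2 j, j \in A & c j != 0)
    & forall t, t \in B -> \sum_(j in A) M t j * c j = 0.
Proof.
move=> ltBA.
pose N := \matrix_(i < #|A|, k < #|B|) M (enum_val k) (enum_val i).
have kN : kermx N != 0.
  rewrite -mxrank_eq0 mxrank_ker -lt0n subn_gt0.
  exact: leq_ltn_trans (rank_leq_col N) ltBA.
pose v := nz_row (kermx N).
have vN : v *m N = 0 by apply/sub_kermxP; apply: nz_row_sub.
have /rV0Pn[i vi] : v != 0 by rewrite nz_row_eq0.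
(* The extension of v by 0 to indices outside A. *)
pose c j := \sum_(k < #|A| | enum_val k == j) v 0 k.
have cE k : c (enum_val k) = v 0 k.
  by rewrite /c (big_pred1 k) // => l; rewrite (inj_eq enum_val_inj).
exists c; first by exists (enum_val i); [exact: enum_valP | rewrite cE].
move=> t tB; rewrite big_enum_val.
have := congr1 (fun w : 'rV_#|B| => w 0 (enum_rank_in tB t)) vN.
rewrite !mxE => sum0; rewrite -[RHS]sum0; apply: eq_bigr => k _.
by rewrite cE !mxE enum_rankK_in // mulrC.
Qed.

(** * Intervals in a chain with a translation *)

Section Precedence.
Local Open Scope order_scope.
Variables (d : Order.disp_t) (X : orderType d) (L : X -> X).
Hypothesis L_homo : {homo L : x y / x <= y}.

Let LL_homo : {homo (fun x => L (L x)) : x y / x <= y}.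
Proof. by move=> x y xy; do 2!apply: L_homo. Qed.

Lemma homo_ltW x y : L x < L y -> x < y.
Proof. by rewrite !ltNge; apply: contraNN; apply: L_homo. Qed.

Definition shift_close (x y u v : X) : bool :=
  [&& u <= L x, x <= L u, v <= L y & y <= L v].

Lemma shift_closeC x y u v : shift_close x y u v = shift_close u v x y.
Proof.
by rewrite /shift_close; case: (u <= _); case: (v <= _); rewrite ?andbF ?andbT.
Qed.

(** The obstruction to the dichotomy of [close_to_either].  In the metric
    setting, where L adds a constant to every point, each of the three cases
    forces x' + y' < x + y, that is, a smaller centre for [x', y'). *)
Definition precedes (x' y' x y : X) : bool :=
  [|| (x' < x) && (y' < y), (L (L x') < x) && (y' <= L (L y))
    | (L (L y') < y) && (x' <= L (L x))].

(** Closeness to [x, y) can only fail through L u < x or L v < y, closeness to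
    [x', y') only through L x' < u or L y' < v; each of the four combinations
    makes [x', y') precede [x, y). *)
Lemma close_to_either x y u v x' y' :
  u <= L x -> v <= L y -> x' <= L u -> y' <= L v -> ~~ precedes x' y' x y ->
  shift_close x y u v || shift_close x' y' u v.
Proof.
move=> ux vy xu yv; apply: contraNT; rewrite negb_or /shift_close ux vy xu yv.
rewrite /= andbT !negb_and -!ltNge => /andP[far far'].
have x'LL : x' <= L (L x) by apply: le_trans xu (L_homo ux).
have y'LL : y' <= L (L y) by apply: le_trans yv (L_homo vy).
rewrite /precedes x'LL y'LL !andbT.
case/orP: far => [Lux|Lvy]; case/orP: far' => [Lxu|Lyv].
- by rewrite (le_lt_trans (L_homo (ltW Lxu)) Lux) orbT.
- by rewrite (le_lt_trans xu Lux) (homo_ltW (lt_le_trans Lyv vy)).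
- by rewrite (le_lt_trans yv Lvy) (homo_ltW (lt_le_trans Lxu ux)).
- by rewrite (le_lt_trans (L_homo (ltW Lyv)) Lvy) !orbT.
Qed.

Hypothesis L_ge : forall x, x <= L x.

(** The relation [precedes] is not transitive, so a minimal element is found
    greedily.  Call i good if no j precedes it in one of the first two ways; an
    interval with the least lower end is good.  Take i good with the least upper
    end.  If some j preceded i in the third way, an interval k with the least
    upper end among those with lo k <= L (L (lo i)) would again be good, with a
    smaller upper end. *)
Lemma exists_unpreceded (S : finType) (lo hi : S -> X) (B : {set S}) :
  B != set0 ->
  exists2 i, i \in B &
    forall j, j \in B -> ~~ precedes (lo j) (hi j) (lo i) (hi i).
Proof.
case/set0Pn=> i0 i0B.
pose low j i := (L (L (lo j)) < lo i) && (hi j <= L (L (hi i))).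
pose good i := [forall j in B,
  ~~ ((lo j < lo i) && (hi j < hi i)) && ~~ low j i].
case: (arg_minP lo i0B) => i1 i1B lo_min.
have good1 : (i1 \in B) && good i1.
  rewrite (i1B : i1 \in B); apply/forall_inP=> j jB.
  rewrite /low !ltNge lo_min //= (le_trans (lo_min j jB)) //.
  exact: le_trans (L_ge _) (L_ge _).
case: (arg_minP (P := [pred i in B | good i]) hi good1) => i.
case/andP=> iB /forall_inP gi hi_min.
exists i => // j jB; have := gi j jB.
rewrite /precedes orbA !negb_or /low => -> /=.
apply/negP=> /andP[hji loji].
case: (arg_minP (P := [pred l in B | lo l <= L (L (lo i))]) hi (i0 := j)).
  by rewrite /= jB.
move=> k /andP[kB lok] k_min.
have hki : L (L (hi k)) < hi i.
  by apply: le_lt_trans (LL_homo _) hji; apply: k_min; rewrite /= jB.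
suff /hi_min : (k \in B) && good k.
  rewrite leNgt (le_lt_trans _ hki) //; exact: le_trans (L_ge _) (L_ge _).
rewrite kB; apply/forall_inP=> l lB; rewrite -negb_or.
apply/norP; split; apply/negP=> /andP[lol hil].
  have : hi k <= hi l by apply: k_min; rewrite /= lB (ltW (lt_le_trans lol lok)).
  by rewrite leNgt hil.
have := gi l lB; rewrite (le_lt_trans hil hki).
by rewrite (homo_ltW (homo_ltW (lt_le_trans lol lok))).
Qed.
End Precedence.

(** * Interval modules *)

Fact plus_le_total (d : Order.disp_t) (P : finOrderType d) :
  total (<=%O : rel (plus P)).
Proof. by case=> [p|] [q|] //=; apply: le_total. Qed.

HB.instance Definition _ (d : Order.disp_t) (P : finOrderType d) :=
  Order.POrder_isTotal.Build d (plus P) (@plus_le_total d P).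

Section IntervalModules.
Variables (K : fieldType) (d : Order.disp_t) (P : finOrderType d).
Implicit Types (p q x y u v : plus P) (L : translation P).

Lemma smap_mor (M N : amod K P) L (f : amor M (tshift N L)) p q
    (h : (p <= q)%O) (w : M p) :
  smap N (t_homo L h) (f p w) = f q (smap M h w).
Proof. by have /lfunP/(_ w) := mfun_nat f h; rewrite !comp_lfunE. Qed.

Lemma mor_nat (M N : amod K P) (f : amor M N) p q (h : (p <= q)%O) (w : M p) :
  smap N h (f p w) = f q (smap M h w).
Proof. by have /lfunP/(_ w) := mfun_nat f h; rewrite !comp_lfunE. Qed.

(** Generators that the structure maps of J carry to each other, together with
    the coordinates relative to them.  Setting the generator to 0 off [x, y) lets
    [smap_gen] hold for all q above p, also beyond the support. *)
Record interval_structure x y (J : amod K P) := IntervalStructure {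
  gen : forall p, J p;
  coef : forall p, 'Hom(J p, K^o);
  gen_out : forall p, ~~ (x <= p < y)%O -> gen p = 0;
  coef_gen : forall p, (x <= p < y)%O -> coef p (gen p) = 1;
  coef_span : forall p (w : J p), w = coef p w *: gen p;
  smap_gen : forall p q (h : (p <= q)%O), (x <= p)%O -> smap J h (gen p) = gen q }.

Lemma notin_supp (M : amod K P) p (w : M p) : p \notin supp M -> w = 0.
Proof.
rewrite inE negbK dimv_eq0 => /eqP M0; apply/eqP.
by rewrite -memv0 -M0 memvf.
Qed.

(** The support is convex because an identity between two of its points factors
    through every point in between; in a chain a convex subset is an interval.
    Its upper end lies in P^+ since no support contains infinity. *)
Lemma supp_interval (M : amod K P) : all_identities M ->
  exists x y, forall p, (p \in supp M) = (x <= p < y)%O.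
Proof.
case=> e eE.
have [M0|[x0 x0M]] := set_0Vmem (supp M).
  exists None, None => p; rewrite M0 inE.
  by apply/esym/negbTE; rewrite negb_and -leNgt orNb.
have vcast_inj p (h : p \in supp M) : injective (vcast (e p h)).
  by case: _ / (e p h).
have mid p q r : p \in supp M -> r \in supp M -> (p <= q <= r)%O -> q \in supp M.
  move=> pM rM /andP[pq qr]; apply: contraLR (pM) => qM.
  rewrite inE negbK dimv_eq0 -subv0; apply/subvP=> w _; rewrite memv0.
  have hpr := le_trans pq qr.
  have := eE p r hpr pM rM.
  have e0 w' : smap M hpr w' = 0.
    by rewrite (smap_comp _ pq qr) comp_lfunE (notin_supp (smap M pq w') qM) linear0.
  move=> ew; apply/eqP/(vcast_inj p pM).
  by rewrite -(ew w) -(ew 0) !e0.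
case: (arg_minP (P := mem (supp M)) id x0M) => x xM x_min.
pose out := [pred q : plus P | (x <= q)%O && (q \notin supp M)].
have outT : out None.
  by rewrite /out /= plus_le_top inE negbK (obj_infty M).
case: (arg_minP (P := out) id outT) => y /andP[xy yM] y_min.
exists x, y => p; apply/idP/andP=> [pM|[xp py]].
  have xp : (x <= p)%O by apply: x_min.
  split=> //; rewrite ltNge; apply: contra yM => yp.
  by apply: mid xM pM _; rewrite xy.
by apply: contraLR py => pM; rewrite -leNgt; apply: y_min; rewrite /out /= xp.
Qed.

Lemma line_coordinate (U : vectType K) (e : U = (K^o : vectType K)) :
  exists g : U, exists c : 'Hom(U, K^o),
    [/\ forall w, c w = vcast e w, c g = 1 & forall w, w = c w *: g].
Proof.
subst U; exists 1, \1%VF; split=> [w||w]; rewrite ?id_lfunE //.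
by rewrite /GRing.scale /= mulr1.
Qed.

Lemma all_identities_interval (M : amod K P) : all_identities M ->
  exists x y, inhabited (interval_structure x y M).
Proof.
move=> idM; have [x [y suppE]] := supp_interval idM.
exists x, y; case: idM => e eE.
have ex p : exists g : M p, exists c : 'Hom(M p, K^o),
    [/\ forall hp w, c w = vcast (e p hp) w, p \in supp M -> c g = 1,
        p \notin supp M -> g = 0 & forall w, w = c w *: g].
  have /orP[hp|hp] := orbN (p \in supp M).
    have [g [c [cE c1 cK]]] := line_coordinate (e p hp).
    by exists g, c; split=> [hp' w|||] //; rewrite ?(bool_irrelevance hp' hp) ?hp.
  exists 0, 0; split=> // [hp'|hp'|w]; try by case/negP: hp.
  by rewrite scaler0; apply: notin_supp.
have [g [c gcE]] : exists (g : forall p, M p) (c : forall p, 'Hom(M p, K^o)),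
    forall p, [/\ forall hp w, c p w = vcast (e p hp) w,
      p \in supp M -> c p (g p) = 1, p \notin supp M -> g p = 0
    & forall w, w = c p w *: g p].
  exists (fun p => projT1 (cid (ex p))).
  exists (fun p => projT1 (cid (projT2 (cid (ex p))))) => p.
  exact: (projT2 (cid (projT2 (cid (ex p))))).
constructor; apply: (@IntervalStructure x y M g c).
- by move=> p; rewrite -suppE => hp; have [_ _ ->] := gcE p.
- by move=> p; rewrite -suppE => hp; have [_ ->] := gcE p.
- by move=> p w; have [_ _ _] := gcE p; apply.
move=> p q pq xp; have [qM|qM] := boolP (q \in supp M); last first.
  by rewrite (notin_supp (smap M pq (g p)) qM) (notin_supp (g q) qM).
have pM : p \in supp M.
  by move: qM; rewrite !suppE xp => /andP[_]; apply: le_lt_trans.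
have [cq cq1 _ cqK] := gcE q; have [cp cp1 _ _] := gcE p.
rewrite [LHS]cqK -[RHS]scale1r; congr (_ *: _).
by rewrite (cq qM) (eE p q pq pM qM) -cp cp1.
Qed.

Lemma iso_interval (M N : amod K P) x y :
  iso M N -> interval_structure x y N -> inhabited (interval_structure x y M).
Proof.
case=> f [g fg] I.
have gf p w : g p (f p w) = w.
  by have [/lfunP/(_ w)] := fg p; rewrite comp_lfunE id_lfunE.
have fgK p w : f p (g p w) = w.
  by have [_ /lfunP/(_ w)] := fg p; rewrite comp_lfunE id_lfunE.
constructor.
apply: (@IntervalStructure x y M (fun p => g p (gen I p))
  (fun p => (coef I p \o f p)%VF)).
- by move=> p hp; rewrite gen_out // linear0.
- by move=> p hp; rewrite comp_lfunE fgK coef_gen.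
- by move=> p w; rewrite comp_lfunE -[LHS]gf {1}(coef_span I (f p w)) linearZ.
- by move=> p q pq xp; rewrite mor_nat (smap_gen I pq xp).
Qed.

Lemma convex_interval (J : amod K P) : convex J ->
  exists x y, inhabited (interval_structure x y J).
Proof.
case=> _ _ [J' [JJ' /all_identities_interval[x [y [I]]]]].
by exists x, y; apply: iso_interval JJ' I.
Qed.

Lemma gen_below x y (J : amod K P) (I : interval_structure x y J) p :
  ~~ (x <= p)%O -> gen I p = 0.
Proof. by move=> xp; rewrite gen_out // (negbTE xp). Qed.

Lemma gen_above x y (J : amod K P) (I : interval_structure x y J) p :
  (y <= p)%O -> gen I p = 0.
Proof. by move=> yp; rewrite gen_out // negb_and -[~~ (_ < _)%O]leNgt yp orbT. Qed.

Section Pair.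
Variables (L : translation P) (x y u v : plus P) (J J' : amod K P).
Variables (I : interval_structure x y J) (I' : interval_structure u v J').

Hypothesis close : shift_close L x y u v.

Definition interval_fun p (w : J p) : J' (L p) := coef I p w *: gen I' (L p).

Fact interval_fun_linear p : linear (@interval_fun p).
Proof. by move=> c w w'; rewrite /interval_fun linearP scalerDl scalerA. Qed.

HB.instance Definition _ p :=
  GRing.isLinear.Build K (J p) (J' (L p)) _ (@interval_fun p)
    (@interval_fun_linear p).

(** Where [x, y) has ended, [u, v) shifted by L has ended too: this is the
    condition v <= L y. *)
Lemma interval_fun_gen p : (x <= p)%O -> interval_fun (gen I p) = gen I' (L p).
Proof.
move=> xp; rewrite /interval_fun.
have [py|yp] := ltP p y; first by rewrite coef_gen ?xp // scale1r.
case/and4P: close => _ _ vy _.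
by rewrite (gen_above I' (le_trans vy (t_homo L yp))) scaler0.
Qed.

Lemma interval_mor_nat p q (h : (p <= q)%O) :
  (smap (tshift J' L) h \o linfun (@interval_fun p))%VF =
  (linfun (@interval_fun q) \o smap J h)%VF.
Proof.
apply/lfunP=> w; rewrite !comp_lfunE; move: (coef I p w) (coef_span I w) => c ->.
rewrite !linearZ /=; congr (_ *: _); rewrite lfunE /=.
have [xp|xp] := boolP (x <= p)%O; last by rewrite gen_below // !linear0.
rewrite (smap_gen I) // [RHS]lfunE /= !interval_fun_gen ?(le_trans xp) //.
apply: smap_gen; case/and4P: close => ux _ _ _.
exact: le_trans ux (t_homo L xp).
Qed.

Definition interval_mor : amor J (tshift J' L) :=
  @AMor K d P J (tshift J' L) _ interval_mor_nat.

Lemma interval_mor_gen p :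
  (x <= p)%O -> interval_mor p (gen I p) = gen I' (L p).
Proof. by move=> xp; rewrite lfunE; apply: interval_fun_gen. Qed.
End Pair.

(** Both maps send generators to generators.  Where a composite could vanish
    because [u, v) has ended, the conditions on upper ends make the canonical map
    vanish as well. *)
Lemma close_interleaved L x y u v (J J' : amod K P) :
  interval_structure x y J -> interval_structure u v J' ->
  shift_close L x y u v -> interleaved J J' L L.
Proof.
move=> I I' cl; have cl' := cl; rewrite shift_closeC in cl'.
exists (interval_mor I I' cl), (interval_mor I' I cl').
have comp x1 y1 u1 v1 (J1 J2 : amod K P) (I1 : interval_structure x1 y1 J1)
    (I2 : interval_structure u1 v1 J2) (c : shift_close L x1 y1 u1 v1)
    (c' : shift_close L u1 v1 x1 y1) p (w : J1 p) :
    interval_mor I2 I1 c' (L p) (interval_mor I1 I2 c p w) =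
    smap J1 (t_comp_ge L L p) w.
  rewrite (coef_span I1 w) !linearZ /=; congr (_ *: _).
  have [xp|xp] := boolP (x1 <= p)%O; last by rewrite gen_below // !linear0.
  apply: etrans (congr1 _ (interval_mor_gen I1 I2 c xp)) _.
  rewrite (smap_gen I1) //; apply: (interval_mor_gen I2 I1 c').
  case/and4P: c => ux _ _ _; exact: le_trans ux (t_homo L xp).
by split=> p; apply/lfunP=> w; rewrite comp_lfunE; apply: comp.
Qed.

(** A map out of an interval module is determined by the image of the generator
    at x, which lies in J at L (L x), past the end of the support. *)
Lemma hom_zero_short L x y (J : amod K P) : interval_structure x y J ->
  (y <= L (L x))%O -> hom_zero J (tshift (tshift J L) L).
Proof.
move=> I short f p; apply/lfunP=> w; rewrite lfunE /=.
rewrite (coef_span I w) linearZ /=.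
have [xp|xp] := boolP (x <= p)%O; last by rewrite gen_below // linear0 scaler0.
have e0 : f x (gen I x) = 0.
  have -> := coef_span I (f x (gen I x) : J (L (L x))).
  by rewrite (gen_above I short) scaler0.
rewrite -(smap_gen I xp (lexx x)).
apply: etrans (congr1 _ (esym (mor_nat f xp (gen I x)))) _.
by rewrite e0 linear0 scaler0.
Qed.

End IntervalModules.

(** * Direct sums of interval modules *)

Section BarcodeBasis.
Variables (K : fieldType) (d : Order.disp_t) (P : finOrderType d).

(** The analogue of [interval_structure] for a direct sum: one family of
    generators for each index in r, with joint coordinates.  Coordinates of
    indices outside r vanish, which makes the empty sum a valid instance. *)
Record barcode_basis (S : eqType) (lo hi : S -> plus P) (r : seq S)
    (N : amod K P) := BarcodeBasis {
  bvec : S -> forall p, N p;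
  bcoef : S -> forall p, 'Hom(N p, K^o);
  bvec_out : forall s p, ~~ (lo s <= p < hi s)%O -> bvec s p = 0;
  bcoef_vec : forall s s' p, bcoef s p (bvec s' p) =
    [&& s == s', s \in r & (lo s <= p < hi s)%O]%:R;
  bcoef_span : forall p (w : N p), w = \sum_(s <- r) bcoef s p w *: bvec s p;
  smap_bvec : forall s p q (h : (p <= q)%O), (lo s <= p)%O ->
    smap N h (bvec s p) = bvec s q }.

Lemma zero_basis (S : eqType) (lo hi : S -> plus P) :
  barcode_basis lo hi [::] (zero_amod K P).
Proof.
apply: (@BarcodeBasis _ _ _ _ (zero_amod K P) (fun _ _ => 0) (fun _ _ => 0)).
- by [].
- by move=> s s' p; rewrite linear0 in_nil andbF.
- by move=> p w; rewrite big_nil; apply: (thinmx0 (w : 'rV[K]_0)).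
- by move=> s p q h _; rewrite linear0.
Qed.

Section Cons.
Variables (S : eqType) (lo hi : S -> plus P) (s0 : S) (r : seq S).
Variables (J N : amod K P).
Variables (I : interval_structure (lo s0) (hi s0) J).
Variables (B : barcode_basis lo hi r N).
Hypothesis s0r : s0 \notin r.

Definition cons_vec s p : dsum J N p :=
  if s == s0 then (gen I p, 0) else (0, bvec B s p).

Definition cons_coef s p (w : dsum J N p) : K^o :=
  if s == s0 then coef I p w.1 else bcoef B s p w.2.

Fact cons_coef_linear s p : linear (@cons_coef s p).
Proof. by move=> c w w'; rewrite /cons_coef; case: eqP; rewrite linearP. Qed.

HB.instance Definition _ s p :=
  GRing.isLinear.Build K (dsum J N p) K^o _ (@cons_coef s p)
    (@cons_coef_linear s p).

Lemma cons_basis : barcode_basis lo hi (s0 :: r) (dsum J N).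
Proof.
apply: (@BarcodeBasis _ _ _ _ (dsum J N) cons_vec
  (fun s p => linfun (@cons_coef s p))).
- move=> s p; rewrite /cons_vec; case: eqP => [->|_] out.
    by rewrite (gen_out I).
  by rewrite bvec_out.
- move=> s s' p; rewrite lfunE /= /cons_coef /cons_vec in_cons.
  have [->|ss0] := eqVneq s s0.
    have [_|s's0] := eqVneq s' s0; last by rewrite linear0.
    case: (boolP (_ <= _ < _)%O) => hp; first exact: coef_gen.
    by rewrite (gen_out I) // linear0.
  have [->|s's0] := eqVneq s' s0; first by rewrite (negbTE ss0) linear0.
  exact: bcoef_vec.
- move=> p [w1 w2]; rewrite big_cons.
  rewrite (eq_big_seq (fun s => (0, bcoef B s p w2 *: bvec B s p))); last first.
    move=> s sr; rewrite lfunE /= /cons_coef /cons_vec.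
    case: eqP sr => [->|_ _]; first by rewrite (negbTE s0r).
    by rewrite -[RHS]/((0, _)) -[in RHS](scaler0 _ (bcoef B s p w2)).
  rewrite lfunE /= /cons_coef /cons_vec eqxx /=.
  have inrD : {morph (fun v => (0, v) : J p * N p) : v v' / v + v' >-> v + v'}.
    by move=> v v'; apply: (congr1 (pair^~ _)); rewrite addr0.
  rewrite -(big_morph _ inrD erefl).
  rewrite -(bcoef_span B w2) {1}(coef_span I w1).
  (* Addition and scaling of pairs compute componentwise. *)
  transitivity (coef I p w1 *: gen I p + 0, coef I p w1 *: 0 + w2) => //.
  by rewrite addr0 scaler0 add0r.
- move=> s p q h; rewrite /cons_vec; case: eqP => [->|_] hp.
    by rewrite pair_lfunE (smap_gen I) // linear0.
  by rewrite pair_lfunE (smap_bvec B) // linear0.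
Qed.
End Cons.

Lemma barcode_basis_sum (S : eqType) (lo hi : S -> plus P) (I_ : S -> amod K P)
    (r : seq S) : uniq r ->
  (forall s, interval_structure (lo s) (hi s) (I_ s)) ->
  barcode_basis lo hi r (\big[@dsum K d P/zero_amod K P]_(s <- r) I_ s).
Proof.
move=> + I; elim: r => [_|s r IH /= /andP[sr /IH B]].
  by rewrite big_nil; apply: zero_basis.
by rewrite big_cons; apply: cons_basis.
Qed.

Section Coordinates.
Variables (S : eqType) (lo hi : S -> plus P) (r : seq S) (N : amod K P).
Variable B : barcode_basis lo hi r N.

Lemma bcoef_out s p (w : N p) : ~~ (lo s <= p < hi s)%O -> bcoef B s p w = 0.
Proof.
move=> out; rewrite (bcoef_span B w) linear_sum big1 // => s' _.
by rewrite linearZ /= bcoef_vec (negbTE out) !andbF /= scaler0.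
Qed.

(** This holds even when p lies before the birth of s: generators not yet born
    at p are 0 there, so the image of a vector at p has no component along them
    at any later q. *)
Lemma bcoef_smap s p q (h : (p <= q)%O) (w : N p) :
  (q < hi s)%O -> bcoef B s q (smap N h w) = bcoef B s p w.
Proof.
move=> qh; rewrite {1 2}(bcoef_span B w) !linear_sum /=.
apply: eq_bigr => s' _; rewrite !linearZ /=; congr (_ *: _).
have [lp|lp] := boolP (lo s' <= p)%O; last first.
  by rewrite bvec_out ?linear0 // (negbTE lp).
rewrite (smap_bvec B) // !bcoef_vec; move: lp; have [<- lp|//] := eqVneq s s'.
by rewrite lp (le_trans lp h) qh (le_lt_trans h qh).
Qed.
End Coordinates.

(** * The matrix of an interleaving *)

Section Entries.
Variables (S T : finType) (L : translation P).
Variables (lo hi : S -> plus P) (N : amod K P).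
Variables (lo' hi' : T -> plus P) (N' : amod K P).
Variables (B : barcode_basis lo hi (index_enum S) N).
Variables (B' : barcode_basis lo' hi' (index_enum T) N').

(** A morphism between interval modules is a scalar.  It is read off at the
    birth of the source interval, whose generator produces all later ones. *)
Definition entry (f : amor N (tshift N' L)) s t : K :=
  bcoef B' t (L (lo s)) (f (lo s) (bvec B s (lo s))).

(** If the target ended strictly after the source, the image of the generator
    would survive at hi s, where the generator itself is already 0. *)
Lemma entry_neq0 (f : amor N (tshift N' L)) s t : entry f s t != 0 ->
  [/\ (lo' t <= L (lo s))%O, (L (lo s) < hi' t)%O & (hi' t <= L (hi s))%O].
Proof.
move=> nz.
have [le_u lt_v] : (lo' t <= L (lo s))%O /\ (L (lo s) < hi' t)%O.
  by apply/andP; apply: contraNT nz => out; rewrite /entry bcoef_out.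
have lt_s : (lo s < hi s)%O.
  rewrite ltNge; apply: contraNN nz => le_s.
  by rewrite /entry bvec_out ?linear0 // lexx ltNge le_s.
split=> //; rewrite leNgt; apply: contraNN nz => lt_y.
have h := ltW lt_s.
rewrite /entry -(bcoef_smap B' (t_homo L h) _ lt_y).
apply/eqP; apply: etrans (congr1 _ (smap_mor f h _)) _.
by rewrite (smap_bvec B) // bvec_out ?linear0 // ltxx andbF.
Qed.
End Entries.

Section Interleaved.
Variables (S T : finType) (L : translation P).
Variables (lo hi : S -> plus P) (N : amod K P).
Variables (lo' hi' : T -> plus P) (N' : amod K P).
Variables (B : barcode_basis lo hi (index_enum S) N).
Variables (B' : barcode_basis lo' hi' (index_enum T) N').
Variables (phi : amor N (tshift N' L)) (psi : amor N' (tshift N L)).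
Hypothesis psi_phi : forall p (w : N p),
  psi (L p) (phi p w) = smap N (t_comp_ge L L p) w.

Local Notation Phi := (entry B B' phi).
Local Notation Psi := (entry B' B psi).

(** The i-j component of psi phi, evaluated on the generator of i at its birth.
    The hypothesis ensures that interval j is still alive at the point reached,
    so that no nonzero product of entries is lost in the evaluation. *)
Lemma sum_entries i j : (L (L (lo i)) < hi j)%O ->
  \sum_t Phi i t * Psi t j = (i == j)%:R.
Proof.
move=> lt_j.
have := congr1 (bcoef B j (L (L (lo i)))) (psi_phi (bvec B i (lo i))).
rewrite (smap_bvec B) // bcoef_vec mem_index_enum /= eq_sym.
have -> : (i == j) && (lo j <= L (L (lo i)) < hi j)%O = (i == j).
  by apply: andb_idr => /eqP ij; rewrite lt_j -ij t_comp_ge.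
move=> <-; rewrite [in RHS](bcoef_span B' (phi _ _)) !linear_sum.
apply: eq_bigr => t _; rewrite !linearZ /=.
have [phi0|nz] := eqVneq (Phi i t) 0.
  by rewrite phi0 mul0r; move: phi0; rewrite /entry => ->; rewrite scale0r.
have [le_u lt_v _] := entry_neq0 nz.
rewrite -(smap_bvec B' le_u (lexx _)) -smap_mor bcoef_smap //.
Qed.

(** If A had fewer partners than elements, a nonzero vector c supported on A
    would be killed by the rows of Psi at the partners of A.  Applying row i of
    Phi, for an unpreceded i in the support of c, would give c i = 0. *)
Lemma hall_condition (A : {set S}) :
  (forall i, i \in A -> L (L (lo i)) < hi i)%O ->
  (#|A| <= #|neighbours (fun i t => shift_close L (lo i) (hi i) (lo' t) (hi' t))
               A|)%N.
Proof.
move=> signif; set E := fun i t => _; rewrite leqNgt; apply/negP.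
case/(wide_system_kernel Psi)=> c [j0 j0A cj0] ker.
pose C := [set j in A | c j != 0].
have L_homo : {homo L : x y / (x <= y)%O} by move=> x y; apply: t_homo.
have [|i] := exists_unpreceded L_homo (t_ge L) lo hi (B := C).
  by apply/set0Pn; exists j0; rewrite inE j0A.
rewrite inE => /andP[iA ci] unprec.
have row j : j \in A -> c j != 0 ->
    \sum_(t in neighbours E A) Phi i t * Psi t j = (i == j)%:R.
  move=> jA cj; have ij : ~~ precedes L (lo j) (hi j) (lo i) (hi i).
    by apply: unprec; rewrite inE jA.
  have lt_j : (L (L (lo i)) < hi j)%O.
    (* Otherwise j, being significant, lies strictly below i at both ends. *)
    rewrite ltNge; apply: contra ij => le_j; apply/or3P/Or31/andP; split.
      by do 2!apply: (homo_ltW L_homo); apply: lt_le_trans (signif j jA) le_j.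
    exact: le_lt_trans le_j (signif i iA).
  rewrite -(sum_entries lt_j) [RHS](bigID (mem (neighbours E A))) /=.
  rewrite [X in _ + X]big1 ?addr0 // => t tN; apply/eqP; apply: contraNT tN.
  rewrite mulf_eq0 negb_or => /andP[/entry_neq0[le_u _ le_v]].
  case/entry_neq0=> le_x _ le_y.
  have /orP[cl|cl] := close_to_either L_homo le_u le_v le_x le_y ij;
    apply/neighboursP.
    by exists i.
  by exists j.
have : \sum_(t in neighbours E A) Phi i t * (\sum_(j in A) Psi t j * c j) = 0.
  by rewrite big1 // => t /ker ->; rewrite mulr0.
under eq_bigr do rewrite big_distrr.
rewrite exchange_big (bigD1 i) //= [X in _ + X]big1 ?addr0.
  under eq_bigr do rewrite mulrA.
  by rewrite -big_distrl /= row // eqxx mul1r => /eqP; apply/negP.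
move=> j /andP[jA ji]; under eq_bigr do rewrite mulrA.
rewrite -big_distrl /=; have [->|cj] := eqVneq (c j) 0; first by rewrite mulr0.
by rewrite row // eq_sym (negbTE ji) mul0r.
Qed.
End Interleaved.

End BarcodeBasis.

(** * From interleavings to matchings *)

Section Stability.
Variables (K : fieldType) (d : Order.disp_t) (P : finOrderType d).

Lemma convex_family (S : finType) (I_ : S -> amod K P) :
  (forall s, convex (I_ s)) ->
  exists lo hi : S -> plus P,
    inhabited (forall s, interval_structure (lo s) (hi s) (I_ s)).
Proof.
move=> cI.
have ex s : exists xy, inhabited (interval_structure xy.1 xy.2 (I_ s)).
  by have [x [y I]] := convex_interval (cI s); exists (x, y).
have [xy I] := choice ex.
exists (fun s => (xy s).1), (fun s => (xy s).2); constructor=> s.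
(* Choosing a structure for each s, where only its existence is known. *)
suff /cid[] : exists _ : interval_structure (xy s).1 (xy s).2 (I_ s), True by [].
by have [J] := I s; exists J.
Qed.

Lemma interleaving_matching (S T : finType) (L : translation P)
    (lo hi : S -> plus P) (N : amod K P)
    (lo' hi' : T -> plus P) (N' : amod K P) :
  barcode_basis lo hi (index_enum S) N ->
  barcode_basis lo' hi' (index_enum T) N' ->
  interleaved N N' L L ->
  exists F : {set S * T},
    [/\ edge_matching F,
        forall p, p \in F ->
          shift_close L (lo p.1) (hi p.1) (lo' p.2) (hi' p.2)
      & forall s, (L (L (lo s)) < hi s)%O -> s \in [set p.1 | p in F]].
Proof.
move=> B B' [phi [psi [psi_phi _]]].
pose A := [set s | (L (L (lo s)) < hi s)%O].
have [|F [mF FE FA]] := @hall_marriage S T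
    (fun s t => shift_close L (lo s) (hi s) (lo' t) (hi' t)) A.
  move=> C CA; apply: (hall_condition B B' (phi := phi) (psi := psi)).
    by move=> p w; have /lfunP/(_ w) := psi_phi p; rewrite comp_lfunE.
  by move=> i /(subsetP CA); rewrite inE.
exists F; split=> // [p /FE[]//|s sig].
by apply: (subsetP FA); rewrite inE.
Qed.

(** The pair (L, L) witnesses that the width is at most the height of L as soon
    as y <= L (L x). *)
Lemma lt_width_significant (a b : nat) (L : translation P) x y (J : amod K P) :
  interval_structure x y J -> (height a b L < width a b J)%N -> (L (L x) < y)%O.
Proof.
move=> I; rewrite ltNge; apply: contraLR; rewrite negbK => short.
rewrite -leqNgt; have [_] := min_natP (ex_width_bound a b J); apply.
by exists L, L; split=> //; apply: hom_zero_short I short.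
Qed.

End Stability.

Theorem theorem2 (K : fieldType) (d : Order.disp_t) (P : finOrderType d)
    (a b : nat) (a_gt0 : (0 < a)%N) (b_gt0 : (0 < b)%N)
    (S T : finType) (I_ : S -> amod K P) (M_ : T -> amod K P)
    (I_convex : forall s : S, convex (I_ s))
    (M_convex : forall t : T, convex (M_ t))
    (eps : nat) (L : translation P)
    (L_max : maximal_translation a b eps L)
    (I_M_interleaved :
       interleaved (\big[@dsum K d P/zero_amod K P]_(s : S) I_ s)
                   (\big[@dsum K d P/zero_amod K P]_(t : T) M_ t) L L) :
  exists f : matching S T, eps_matching a b I_ M_ (height a b L) f.
Proof.
have [lo [hi [I]]] := convex_family I_convex.
have [lo' [hi' [I']]] := convex_family M_convex.
have B := barcode_basis_sum (index_enum_uniq S) I.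
have B' := barcode_basis_sum (index_enum_uniq T) I'.
have [F [mF FE FS]] := interleaving_matching B B' I_M_interleaved.
have M_I_interleaved : interleaved
    (\big[@dsum K d P/zero_amod K P]_(t : T) M_ t)
    (\big[@dsum K d P/zero_amod K P]_(s : S) I_ s) L L.
  by case: I_M_interleaved => phi [psi [h h']]; exists psi, phi; split.
have [G0 [mG0 G0E G0T]] := interleaving_matching B' B M_I_interleaved.
pose swap (p : T * S) := (p.2, p.1).
pose G := [set swap p | p in G0].
have mG : edge_matching G.
  by move=> _ _ /imsetP[p pG ->] /imsetP[q qG ->]; rewrite (mG0 p q).
have [||H [mH HFG HS HT]] := mendelsohn_dulmage mF mG
    (A := [set s | (L (L (lo s)) < hi s)%O])
    (B := [set t | (L (L (lo' t)) < hi' t)%O]).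
- by apply/subsetP=> s; rewrite inE; apply: FS.
- apply/subsetP=> t; rewrite inE => /G0T/imsetP[p pG ->].
  by apply/imsetP; exists (swap p); rewrite // imset_f.
have H_close p : p \in H -> shift_close L (lo p.1) (hi p.1) (lo' p.2) (hi' p.2).
  move/(subsetP HFG); rewrite inE => /orP[/FE//|/imsetP[q /G0E cl ->]].
  by rewrite shift_closeC.
have [f [fS fT fH]] := edge_matching_bij mH; exists f; split.
- by move=> s /(lt_width_significant (I s)) sig; rewrite fS (subsetP HS) // inE.
- by move=> t /(lt_width_significant (I' t)) sig; rewrite fT (subsetP HT) // inE.
move=> s; have [_] := min_natP
  (ex_interleaving_bound a b (I_ (val s)) (M_ (val (f s)))).
apply; exists L, L; split=> //; apply: close_interleaved (I _) (I' _) _.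
exact: H_close (fH s).
Qed.
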